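(* Let $\mathcal{A}$ be a nonempty central arrangement of hyperplanes in $\mathbb{C}^{d+1}$. Then the Milnor fibration of the arrangement $$Q:M(\mathcal{A})\to\mathbb{C}^\ast$$ admits a continuous (global) cross-section, i.e. there is a continuous map $s:\mathbb{C}^\ast\to M(\mathcal{A})$ with $Q\circ s=1_{\mathbb{C}^\ast}$.
   Context: A central arrangement of hyperplanes in $\mathbb{C}^{d+1}$ is a finite set $\mathcal{A}$ of codimension-one linear subspaces of $\mathbb{C}^{d+1}$ (all passing through the origin). For each $H\in\mathcal{A}$ let $L_H:\mathbb{C}^{d+1}\to\mathbb{C}$ be a linear form with kernel $H$, and set $Q=Q(\mathcal{A})=\prod_{H\in\mathcal{A}}L_H$, a homogeneous polynomial of degree $|\mathcal{A}|$. The complement of the arrangement is $M(\mathcal{A})=\mathbb{C}^{d+1}-\bigcup_{H\in\mathcal{A}}H$. The restricted polynomial map $Q:M(\mathcal{A})\to\mathbb{C}^\ast=\mathbb{C}\setminus\{0\}$ is the projection of a smooth locally trivial bundle, called the Milnor fibration of the arrangement. *)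

(* Defs.v *)
From HB Require Import structures.
From mathcomp Require Import all_boot all_order all_algebra finmap complex.
From mathcomp Require Import all_classical all_reals all_analysis.

Set Implicit Arguments.
Unset Strict Implicit.
Unset Printing Implicit Defensive.

Import Order.TTheory GRing.Theory Num.Theory.
Import numFieldNormedType.Exports.

Local Open Scope classical_set_scope.
Local Open Scope ring_scope.

(* The library puts the modulus topology on the alias R[i]^o and on abstract
   numFieldTypes, but not on R[i] itself.  These instances transfer it, so that
   R[i] and 'cV[R[i]]_n are normed spaces with their Euclidean topology. *)
HB.instance Definition _ (R : realType) := GRing.ComAlgebra.copy R[i] R[i]^o.
HB.instance Definition _ (R : realType) := Vector.copy R[i] R[i]^o.
HB.instance Definition _ (R : realType) := NormedModule.copy R[i] R[i]^o.

Definition hyperplane (K : fieldType) (V : vectType K) (H : {vspace V}) : Prop :=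
  (\dim H).+1 = \dim {:V}.

(* Centrality is built in: the hyperplanes are linear, not affine, subspaces. *)
Definition central_arrangement (K : fieldType) (V : vectType K)
    (A : {fset {vspace V}}) : Prop :=
  forall H, H \in A -> hyperplane H.

Definition complement (K : fieldType) (V : vectType K)
    (A : {fset {vspace V}}) : set V :=
  ~` \bigcup_(H in [set` A]) [set` H].

(* L is only constrained on the members of A; its other values are junk. *)
Definition defining_forms (R : realType) (V : vectType R[i])
    (A : {fset {vspace V}}) (L : {vspace V} -> 'Hom(V, R[i])) : Prop :=
  forall H, H \in A -> lker (L H) = H.

Definition defining_polynomial (R : realType) (V : vectType R[i])
    (A : {fset {vspace V}}) (L : {vspace V} -> 'Hom(V, R[i])) (x : V) : R[i] :=
  \prod_(H <- A) L H x.

(* p, restricted to E -> B, has a continuous section; the values of s outside B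
   are irrelevant, since {within B, continuous s} refers to the subspace B. *)
Definition has_continuous_section (X Y : topologicalType)
    (E : set X) (B : set Y) (p : X -> Y) : Prop :=
  exists s : Y -> X,
    [/\ {within B, continuous s},
        forall z, B z -> E (s z) &
        forall z, B z -> p (s z) = z].

(* Main.v *)
Require Import Defs.
From HB Require Import structures.
From mathcomp Require Import all_boot all_order all_algebra finmap complex.
From mathcomp Require Import all_classical all_reals all_analysis.
From mathcomp Require Import ring lra.

Set Implicit Arguments.
Unset Strict Implicit.
Unset Printing Implicit Defensive.

Import Order.TTheory GRing.Theory Num.Theory.
Import numFieldNormedType.Exports.

Local Open Scope classical_set_scope.
Local Open Scope ring_scope.

(* Pick a member H0 of A, a point p of H0 lying on no other member, and q off H0,
   scaled so that Q(p + u q) = u g(u) with g(0) = 1.  On a disc |u| < e the values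
   of g lie in the right half-plane, where there is a continuous n-th root for
   n = |A|.  By homogeneity Q(lam (p + u q)) = lam^n u g(u).  With
   u = e z / (1 + |z|^2), which stays in that disc for all z, solving
   lam^n u g(u) = z amounts to taking an n-th root of the positive multiple
   (1 + |z|^2) / e of 1 / g(u). *)

(** * Generic points of a hyperplane *)

Lemma exists_notin_seq (K : numDomainType) (s : seq K) : exists x : K, x \notin s.
Proof.
(* This number has larger modulus than every entry of [s]. *)
exists (1 + \sum_(a <- s) `|a|); apply/negP => xs.
have : `|1 + \sum_(a <- s) `|a| | <= \sum_(a <- s) `|a|.
  by rewrite [leRHS](big_rem _ xs)/= lerDl sumr_ge0.
by rewrite ger0_norm ?addr_ge0 ?sumr_ge0// gerDr ler10.
Qed.

(** An infinite field leaves room to avoid finitely many proper subspaces of [U]: a point good for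
    the tail is moved along some [w] on which the new form does not vanish. *)
Lemma exists_avoiding_kernels (K : numFieldType) (V : vectType K) (I : eqType)
    (U : {vspace V}) (f : I -> 'Hom(V, K^o)) (s : seq I) :
  (forall i, i \in s -> exists2 w, w \in U & f i w != 0) ->
  exists2 p, p \in U & forall i, i \in s -> f i p != 0.
Proof.
elim: s => [_|i s IHs sP]; first by exists 0; rewrite ?mem0v.
have [p pU fp] := IHs (fun j js => sP j (mem_behead (s := i :: s) js)).
have [w wU fw] := sP i (mem_head _ _).
(* For [f j w != 0] the listed value is the only [t] with [f j (p + t *: w) = 0]. For [f j w = 0]
   the entry is a harmless division by zero, as moving along [w] leaves [f j p] unchanged. *)
have [t] := exists_notin_seq [seq - (f j p : K) / f j w | j <- i :: s].
move=> /mapP tN; exists (p + t *: w); first by rewrite rpredD// rpredZ.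
move=> j js; apply/eqP; rewrite linearD linearZ/= => fj0.
have [fjw0|fjw0] := eqVneq (f j w) 0.
  move: js fj0; rewrite inE fjw0 scaler0 addr0 => /predU1P[ji|js fj0].
    by move: fw; rewrite -ji fjw0 eqxx.
  by have := fp _ js; rewrite fj0 eqxx.
apply: tN; exists j => //.
by apply: (mulIf fjw0); rewrite mulfVK//; apply/eqP; rewrite -addr_eq0 addrC fj0.
Qed.

Lemma hyperplane_separation (K : fieldType) (V : vectType K) (H H' : {vspace V}) :
  hyperplane H -> hyperplane H' -> H != H' -> exists2 w, w \in H & w \notin H'.
Proof.
rewrite /hyperplane => dH dH' HH'; apply: (@subvPn _ _ H H').
apply: contra HH' => sHH'; rewrite eqEdim sHH'/=.
by rewrite -ltnS dH dH'.
Qed.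

Lemma hyperplane_proper (K : fieldType) (V : vectType K) (H : {vspace V}) :
  hyperplane H -> exists w, w \notin H.
Proof.
rewrite /hyperplane => dH.
have /subvPn[w _ wH] : ~~ (fullv <= H)%VS; last by exists w.
by apply/negP => /dimvS; rewrite -dH ltnn.
Qed.

(** * Limits and continuity of complex-valued functions *)

Lemma cvg_prodr (K : numFieldType) (T I : Type) (F : set_system T)
    (FF : Filter F) (s : seq I) (f : I -> T -> K) (l : I -> K) :
  (forall i, f i @ F --> l i) ->
  (fun t => \prod_(i <- s) f i t) @ F --> \prod_(i <- s) l i.
Proof.
move=> fl; elim: s => [|i s IHs].
  by rewrite big_nil; under eq_fun do rewrite big_nil; exact: cvg_cst.
by rewrite big_cons; under eq_fun do rewrite big_cons; exact: cvgM.
Qed.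

Section ComplexContinuity.
Variable R : realType.

(* [zF] is supplied by hand, here and below: unification unfolds [nbhs z] for
   [z : R[i]], after which type class search no longer recognises a filter. *)
Lemma continuous_Re : continuous (fun z : R[i] => complex.Re z).
Proof.
move=> z; have zF := @nbhs_filter R[i] z; apply/cvgrPdist_lt => e e0.
have zP : \forall w \near z, `|z - w| < e%:C%C.
  have /cvgrPdist_lt : (id : R[i] -> R[i]) @ z --> z by exact: cvg_id.
  by apply; rewrite ltcR.
apply: (@filterS R[i] (nbhs z) _ _ _ _ zP) => w.
rewrite -ltcR => zw; apply: le_lt_trans zw.
by rewrite -raddfB; exact: normc_ge_Re.
Qed.

Lemma continuous_real_complex : continuous (fun x : R => x%:C%C : R[i]).
Proof.
(* In the partial order of [R[i]], a positive [e] is real, so the estimate becomes a real one. *)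
move=> x; apply/cvgrPdist_lt => e; rewrite ltcE/= => /andP[/eqP eI eR].
have : \forall y \near x, `|x - y| < complex.Re e.
  have /cvgrPdist_lt : (id : R -> R) @ x --> x by exact: cvg_id.
  by apply.
apply: filterS => y xy.
have -> : e = (complex.Re e)%:C%C by case: e eI {eR xy} => a b /= ->.
by rewrite -rmorphB normc_def/= expr0n addr0 sqrtr_sqr ltcR.
Qed.

Lemma cvg_real_complex (T : Type) (F : set_system T) (f : T -> R) (a : R) :
  f @ F --> a -> ((fun t => (f t)%:C%C) : T -> R[i]) @ F --> (a%:C%C : R[i]).
Proof.
move=> fa.
exact: (@cvg_comp T R R[i] f (real_complex R) F _ _ fa (@continuous_real_complex a)).
Qed.

Lemma continuous_Im : continuous (fun z : R[i] => complex.Im z).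
Proof.
have -> : (fun z : R[i] => complex.Im z) = (fun z => complex.Re (- 'i%C * z)).
  by apply/funext => -[a b] /=; rewrite mulN1r opprK oppr0 mul0r add0r.
move=> z; apply: (@continuous_comp _ _ _ ( *%R (- 'i%C)) (@complex.Re R)).
  exact: mulrl_continuous.
exact: continuous_Re.
Qed.

Lemma cvg_complex (T : Type) (F : set_system T) (FF : Filter F)
    (u v : T -> R) (a b : R) :
  u @ F --> a -> v @ F --> b ->
  ((fun t => u t +i* v t)%C : T -> R[i]) @ F --> (a +i* b : R[i])%C.
Proof.
move=> ua vb.
have E x y : (x +i* y = x%:C + 'i * y%:C :> R[i])%C by rewrite [LHS]complexE.
rewrite (_ : (fun t => _) = fun t => ((u t)%:C + 'i * (v t)%:C : R[i])%C); last first.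
  by apply/funext => t; exact: E.
rewrite (E a); apply: cvgD; last (apply: cvgM; first exact: cvg_cst).
  exact: cvg_real_complex.
exact: cvg_real_complex.
Qed.

Lemma cvg_for_comp (T : Type) (F : set_system T) (f : T -> R) (g : R -> R) (a : R) :
  {for a, continuous g} -> f @ F --> a -> (fun t => g (f t)) @ F --> g a.
Proof. by move=> ga fa; exact: (@cvg_comp _ _ _ f g _ _ _ fa ga). Qed.

(** * Polar form and roots on the right half-plane *)

Lemma de_moivre (x : R) n :
  ((cos x +i* sin x) ^+ n = cos (x *+ n) +i* sin (x *+ n) :> R[i])%C.
Proof.
elim: n => [|n IHn]; first by rewrite expr0 mulr0n cos0 sin0.
rewrite exprS IHn mulrS cosD sinD; apply/eqP.
by rewrite eq_complex/= eqxx/= addrC (mulrC (cos x)).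
Qed.

Lemma polar_expX (rho x : R) n :
  ((rho%:C * (cos x +i* sin x)) ^+ n =
   (rho ^+ n)%:C * (cos (x *+ n) +i* sin (x *+ n)) :> R[i])%C.
Proof.
have -> := exprMn n (rho%:C : R[i])%C (cos x +i* sin x)%C.
by rewrite de_moivre rmorphXn.
Qed.

Lemma polar_atan (w : R[i]) (th := atan (complex.Im w / complex.Re w)) :
  0 < complex.Re w ->
  ((complex.Re w / cos th)%:C * (cos th +i* sin th))%C = w.
Proof.
case: w @th => a b th /= a0.
have /lt0r_neq0 costh : 0 < cos th.
  by rewrite cos_gt0_pihalf// atan_gtNpi2 atan_ltpi2.
have {}a0 := lt0r_neq0 a0.
have sinth : sin th = b / a * cos th.
  by rewrite -[X in _ = X * _]atanK /tan divfK.
apply/eqP; rewrite eq_complex/= !mul0r subr0 addr0 sinth divfK// eqxx/=.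
by apply/eqP; field; rewrite a0.
Qed.

(** This is the principal branch: in the polar form of [polar_atan] the argument is divided by [n],
    and the modulus gets its real root as exp(ln / n). All functions involved are continuous where
    the real part is positive. *)
Lemma exists_continuous_root (n : nat) : (0 < n)%N ->
  exists r : R[i] -> R[i], forall w, 0 < complex.Re w ->
    r w ^+ n = w /\ {for w, continuous r}.
Proof.
move=> n0.
have nE : n%:R != 0 :> R by rewrite pnatr_eq0 -lt0n.
pose th (w : R[i]) : R := atan (complex.Im w / complex.Re w).
pose m (w : R[i]) : R := complex.Re w / cos (th w).
have costh w : 0 < cos (th w).
  by rewrite cos_gt0_pihalf// atan_gtNpi2 atan_ltpi2.
pose rho w := expR (ln (m w) / n%:R).
pose ph w := th w / n%:R.
exists (fun w => ((rho w)%:C * (cos (ph w) +i* sin (ph w)))%C) => w w0.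
have m0 : 0 < m w by rewrite divr_gt0.
split.
  rewrite polar_expX -expRM_natr -(mulr_natr (ph w)) !divfK// lnK ?posrE//.
  exact: polar_atan.
have wF := @nbhs_filter R[i] w.
have wRe : complex.Re x @[x --> w] --> complex.Re w := @continuous_Re w.
have wth : th x @[x --> w] --> th w.
  apply: (cvg_for_comp (@continuous_atan R _)).
  apply: cvgM; first exact: continuous_Im.
  by apply: cvgV; first by rewrite gt_eqF.
have wph : ph x @[x --> w] --> ph w.
  by apply: cvgM; [exact: wth|exact: cvg_cst].
have wrho : rho x @[x --> w] --> rho w.
  apply: (cvg_for_comp (@continuous_expR R _)).
  apply: cvgM; last exact: cvg_cst.
  apply: (cvg_for_comp (@continuous_ln R _ m0)).
  apply: cvgM; first exact: wRe.
  apply: cvgV; first by rewrite gt_eqF.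
  exact: (cvg_for_comp (@continuous_cos R _) wth).
apply: cvgM; first exact: (cvg_real_complex wrho).
apply: cvg_complex.
  exact: (cvg_for_comp (@continuous_cos R _) wph).
exact: (cvg_for_comp (@continuous_sin R _) wph).
Qed.

Lemma exists_pos_Re_ball (g : R[i] -> R[i]) :
  {for 0, continuous g} -> g 0 = 1 ->
  exists2 e : R, 0 < e & forall u, `|u| < e%:C%C -> 0 < complex.Re (g u).
Proof.
move=> gc g0.
have zF := @nbhs_filter R[i] (0 : R[i]).
have : complex.Re (g x) @[x --> (0 : R[i])] --> complex.Re (g 0).
  exact: (@cvg_comp R[i] R[i] R g (@complex.Re R) (nbhs (0 : R[i]))
    _ _ gc (@continuous_Re (g 0))).
(* A deviation below 1 from [Re (g 0) = 1] keeps the real part positive. *)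
move=> /cvgrPdist_lt/(_ 1 ltr01); rewrite g0 /=.
move=> /nbhs_ballP[e /= e0 eP].
have [er e0'] : 0 < complex.Re e /\ e = (complex.Re e)%:C%C.
  by move: e0; case: (e) => a b; rewrite ltcE/= => /andP[/eqP ->].
exists (complex.Re e) => // u; rewrite -e0' => ue.
have := eP u; rewrite -ball_normE/= sub0r normrN => /(_ ue).
by rewrite ltr_norml => /andP[_]; rewrite ltrBlDr ltrDl.
Qed.

(** * Global solution of the rescaling equation *)

Lemma continuous_sqr_modulus :
  continuous (fun z : R[i] => complex.Re z ^+ 2 + complex.Im z ^+ 2).
Proof.
move=> z; have zF := @nbhs_filter R[i] z.
have zr : complex.Re x @[x --> z] --> complex.Re z := @continuous_Re z.
have zi : complex.Im x @[x --> z] --> complex.Im z := @continuous_Im z.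
by apply: cvgD; rewrite expr2; under eq_fun do rewrite expr2; apply: cvgM.
Qed.

(** Since [u z] is a positive real multiple of [z], the quotient of [z] by [u z * g (u z)] extends
    over 0 and stays in the right half-plane, so its root has no monodromy around 0. *)
Lemma exists_continuous_rescaling (n : nat) (g : R[i] -> R[i]) :
  (0 < n)%N -> continuous g -> g 0 = 1 ->
  exists lam u : R[i] -> R[i], [/\ continuous lam, continuous u &
    forall z, lam z ^+ n * (u z * g (u z)) = z].
Proof.
move=> n0 gc g0.
have [r rP] := exists_continuous_root n0.
have [e e0 eP] := exists_pos_Re_ball (gc 0) g0.
pose a (z : R[i]) : R := 1 + (complex.Re z ^+ 2 + complex.Im z ^+ 2).
have a0 z : 0 < a z by rewrite ltr_wpDr// addr_ge0// sqr_ge0.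
pose u (z : R[i]) : R[i] := (e / a z)%:C%C * z.
have ue z : `|u z| < e%:C%C.
  have -> : `|u z| = `|(e / a z)%:C%C : R[i]| * `|z| by exact: normrM.
  rewrite !normc_def/= expr0n addr0 sqrtr_sqr ger0_norm ?divr_ge0 1?ltW//.
  rewrite -rmorphM ltcR mulrAC ltr_pdivrMr// ltr_pM2l// /a.
  set t := _ + _; have t0 : 0 <= t by rewrite addr_ge0// sqr_ge0.
  (* With x the modulus of [z], the claim is x < 1 + x^2. *)
  have := sqr_sqrtr t0; move: (Num.sqrt t) => x <-; nra.
have gu0 z : 0 < complex.Re (g (u z)) by exact: eP.
(* The factor [a z / e] is z / u with [z] cancelled, hence meaningful at [z = 0] too. *)
pose w z : R[i] := (a z / e)%:C%C * (g (u z))^-1.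
have w0 z : 0 < complex.Re (w z).
  rewrite /w; move: (gu0 z); case: (g (u z)) => x y /= x0.
  by rewrite mul0r subr0 mulr_gt0 ?divr_gt0// ltr_wpDr ?sqr_ge0// exprn_gt0.
have cont_a : continuous a.
  move=> z; have zF := @nbhs_filter R[i] z.
  by apply: cvgD; [exact: cvg_cst|exact: continuous_sqr_modulus].
have cu : continuous u.
  move=> z; have zF := @nbhs_filter R[i] z.
  apply: cvgM; last exact: cvg_id.
  apply: cvg_real_complex.
  apply: cvgM; first exact: cvg_cst.
  by apply: cvgV; [rewrite gt_eqF|exact: cont_a].
have cgu : continuous (g \o u).
  by move=> z; apply: (@cvg_comp R[i] R[i] R[i] u g (nbhs z) _ _ (cu z) (gc (u z))).
have gun z : g (u z) != 0.
  by apply: contraTneq (gu0 z) => ->; rewrite ltxx.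
have cw : continuous w.
  move=> z; have zF := @nbhs_filter R[i] z.
  apply: cvgM; last by apply: cvgV; [exact: gun|exact: cgu].
  apply: cvg_real_complex.
  by apply: cvgM; [exact: cont_a|exact: cvg_cst].
exists (fun z => r (w z)), u; split; [|exact: cu|].
  move=> z; have [_ rc] := rP _ (w0 z).
  exact: (@cvg_comp R[i] R[i] R[i] w r (nbhs z) _ _ (cw z) rc).
move=> z; have [-> _] := rP _ (w0 z).
rewrite /w {1}/u; set G := g _; have G0 : G != 0 := gun z.
have -> x y : (x%:C * G^-1 * (y%:C * z * G) = (x * y)%:C * z * (G^-1 * G) :> R[i])%C.
  by rewrite rmorphM; ring.
rewrite mulVf// mulr1 -[RHS]mul1r; congr (_ * _).
by have -> : a z / e * (e / a z) = 1 by field; rewrite !lt0r_neq0.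
Qed.

End ComplexContinuity.

(** * The section of the Milnor fibration *)

Theorem proposition4p5 (R : realType) (d : nat)
    (A : {fset {vspace 'cV[R[i]]_d.+1}})
    (L : {vspace 'cV[R[i]]_d.+1} -> 'Hom('cV[R[i]]_d.+1, R[i])) :
  A != fset0 ->
  central_arrangement A ->
  defining_forms A L ->
  has_continuous_section (complement A) [set z : R[i] | z != 0]
    (defining_polynomial A L).
Proof.
move=> /fset0Pn[H0 H0A] cA dL.
have memL H x : H \in A -> (x \in H) = (L H x == 0).
  by move=> HA; rewrite -{1}(dL H HA) memv_ker.
have [p pH0 Lp] : exists2 p, p \in H0 &
    forall H, H \in (A `\ H0)%fset -> L H p != 0.
  apply: (@exists_avoiding_kernels R[i] _ _ H0 L (A `\ H0)%fset) => H.
  rewrite in_fsetD1 => /andP[HH0 HA].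
  have [|w wH0 wH] := hyperplane_separation (cA _ H0A) (cA _ HA).
    by rewrite eq_sym.
  by exists w; rewrite -?memL.
have [q0 q0H] := hyperplane_proper (cA _ H0A).
rewrite memL// in q0H.
pose c : R[i] := \prod_(H <- (A `\ H0)%fset) L H p.
have c0 : c != 0.
  by rewrite /c prodf_seq_neq0; apply/allP => H /Lp.
(* This scaling is what gives [g 0 = 1] below. *)
pose q := (L H0 q0 * c)^-1 *: q0.
have Lq : L H0 q * c = 1.
  rewrite /q linearZ /= -[X in X * c]/((L H0 q0 * c)^-1 * L H0 q0).
  by rewrite -mulrA mulVf// mulf_neq0.
(* As [L H0 p = 0], the factor of [H0] at [p + u *: q] is [u * L H0 q]; [g] is what remains of Q
   after removing [u]. *)
pose g (u : R[i]) : R[i] :=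
  L H0 q * \prod_(H <- (A `\ H0)%fset) (L H p + u * L H q).
have gc : continuous g.
  move=> z; apply: (@cvgM R[i] R[i] (nbhs z) (@nbhs_filter R[i] z)).
    exact: cvg_cst.
  apply: (@cvg_prodr R[i] R[i] _ (nbhs z) (@nbhs_filter R[i] z) _
    (fun H u => L H p + u * L H q) (fun H => L H p + z * L H q)) => H.
  have zF := @nbhs_filter R[i] z.
  apply: cvgD; first exact: cvg_cst.
  by apply: cvgM; [exact: cvg_id|exact: cvg_cst].
have g0 : g 0 = 1.
  by rewrite -Lq /g /c; congr (_ * _); apply: eq_bigr => H _; rewrite mul0r addr0.
have n0 : (0 < #|` A|)%N by rewrite cardfs_gt0; apply/fset0Pn; exists H0.
have [lam [u [lamc uc lamu]]] := @exists_continuous_rescaling R _ g n0 gc g0.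
pose s (z : R[i]) := lam z *: (p + u z *: q).
have Qs z : defining_polynomial A L (s z) = z.
  rewrite -[RHS]lamu /defining_polynomial.
  rewrite (eq_bigr (fun H => lam z * (L H p + u z * L H q))); last first.
    by move=> H _; rewrite /s linearZ linearD linearZ.
  rewrite big_split/= big_const_seq count_predT iter_mulr_1.
  have /eqP Lp0 : L H0 p == 0 by rewrite -memL.
  by rewrite (big_fsetD1 _ H0A)/= Lp0 add0r -mulrA.
exists s; split; [|move=> z z0|by move=> z _; exact: Qs].
(* The map [s] is continuous on the whole plane, although [s 0] lies in [H0]. *)
- apply: continuous_subspaceT => z; have zF := @nbhs_filter R[i] z.
  apply: cvgZ; first exact: lamc.
  apply: cvgD; first exact: cvg_cst.
  by apply: cvgZ; [exact: uc|exact: cvg_cst].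
(* A point [s z] on some member would give z = Q(s z) = 0. *)
- move=> [H /= HA]; rewrite memL// => /eqP sH.
  move: z0; rewrite /= -(Qs z) /defining_polynomial (big_fsetD1 _ HA)/= sH.
  by rewrite mul0r eqxx.
Qed.
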